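(* Let $\mathcal{S}=\{(x,y)\in\mathbb{Z}^2 : x>y\ge 1,\ x(x+1)=10\,y(y+1)\}$. Define the sequence of pairs $(x_n,y_n)_{n\ge 1}$ by the initial values $$(x_1,y_1)=(4,1),\quad (x_2,y_2)=(20,6),\quad (x_3,y_3)=(39,12),$$ and, for $n\ge 1$, $$x_{n+3}=19x_n+60y_n+39,\qquad y_{n+3}=6x_n+19y_n+12.$$ Then $\mathcal{S}=\{(x_n,y_n) : n\ge 1\}$. *)

(* Defs.v *)
(* Stdlib world *)
From Stdlib Require Export ZArith.

Open Scope Z_scope.

Definition S_set (p : Z * Z) : Prop :=
  let (x, y) := p in x > y /\ y >= 1 /\ x * (x + 1) = 10 * y * (y + 1).

(* The sequence is indexed from 1; the value at index 0 is a dummy. *)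
Fixpoint xy_seq (n : nat) : Z * Z :=
  match n with
  | 0%nat => (0, 0)
  | 1%nat => (4, 1)
  | 2%nat => (20, 6)
  | 3%nat => (39, 12)
  | S (S (S m)) =>
      let (x, y) := xy_seq m in
      (19 * x + 60 * y + 39, 6 * x + 19 * y + 12)
  end.

(* Main.v *)
(** In terms of [X = 2x + 1] and [Y = 2y + 1] the equation is the Pell equation
    [X^2 - 10 Y^2 = -9], and the recursion is multiplication by the unit
    [19 + 6 sqrt 10].  Multiplication by the inverse unit strictly decreases
    [y] and stays inside [S_set] as soon as [y > 12]; for [y <= 12] one has
    [x = 3 y + k] with [k] in [{1, 2, 3}], each giving one initial pair. *)
Require Import Defs.
From Stdlib Require Import ZArith Lia.

(** The dummy [(0, 0)] obeys the recursion too, being sent to [(39, 12)]. *)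
Lemma xy_seq_step (n : nat) :
  xy_seq (3 + n) =
  let (x, y) := xy_seq n in (19 * x + 60 * y + 39, 6 * x + 19 * y + 12).
Proof. destruct n; reflexivity. Qed.

Lemma S_set_step (x y : Z) :
  S_set (x, y) -> S_set (19 * x + 60 * y + 39, 6 * x + 19 * y + 12).
Proof. unfold S_set. intros (Hxy & Hy & E). repeat split; nia. Qed.

Lemma xy_seq_in_S_set (n : nat) : S_set (xy_seq (S n)).
Proof.
  induction n as [n IH] using (well_founded_induction lt_wf).
  destruct n as [|[|[|n]]]; [cbn; lia .. |].
  change (S (S (S (S n)))) with (3 + S n)%nat.
  rewrite xy_seq_step.
  specialize (IH n ltac:(lia)).
  destruct (xy_seq (S n)) as [x y].
  now apply S_set_step.
Qed.

(** Otherwise [x * (x + 1) <= 9 y^2 + 3 y < 10 y (y + 1)]. *)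
Lemma S_set_lower_bound (x y : Z) : S_set (x, y) -> 3 * y + 1 <= x.
Proof. unfold S_set. intros (Hxy & Hy & E). nia. Qed.

Lemma S_set_small (x y : Z) :
  S_set (x, y) -> y <= 12 ->
  (x, y) = (4, 1) \/ (x, y) = (20, 6) \/ (x, y) = (39, 12).
Proof.
  intros H Hle.
  pose proof (S_set_lower_bound x y H) as Hlow.
  destruct H as (Hxy & Hy & E).
  (* [x >= 3 y + 4] would force [y^2 - 17 y - 20 >= 0], so [y >= 19]. *)
  assert (Hup : x <= 3 * y + 3) by nia.
  assert (Hk : x = 3 * y + 1 \/ x = 3 * y + 2 \/ x = 3 * y + 3) by lia.
  destruct Hk as [-> | [-> | ->]].
  - left. assert (y = 1) by nia. now subst y.
  - right; left. assert (F : (y - 6) * (y + 1) = 0) by lia.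
    assert (y = 6) by nia. now subst y.
  - right; right. assert (F : (y - 12) * (y + 1) = 0) by lia.
    assert (y = 12) by nia. now subst y.
Qed.

Lemma S_set_descent (x y : Z) :
  S_set (x, y) -> 12 < y ->
  S_set (19 * x - 60 * y - 21, - 6 * x + 19 * y + 6) /\ - 6 * x + 19 * y + 6 < y.
Proof.
  intros H Hlt.
  pose proof (S_set_lower_bound x y H) as Hlow.
  destruct H as (Hxy & Hy & E).
  (* [x = 3 y + 1] forces [y = 1]; excluding it is what makes [y] decrease. *)
  assert (Hstrict : 3 * y + 2 <= x) by nia.
  (* This says that the new pair still has [x > y]. It reads [79 Y < 25 X]; squaring and using the
     Pell equation turns it into [Y^2 > 625], which is exactly [y > 12]. *)
  assert (Hratio : 79 * y + 27 < 25 * x) by nia.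
  (* [Y^2 - 38 Y + 325 = (Y - 13) (Y - 25)] is positive for [Y = 2 y + 1 > 25]. *)
  assert (Hpos : 6 * x < 19 * y + 6) by nia.
  unfold S_set. repeat split; nia.
Qed.

Lemma S_set_in_xy_seq (x y : Z) :
  S_set (x, y) -> exists n : nat, (1 <= n)%nat /\ (x, y) = xy_seq n.
Proof.
  intros H.
  assert (Hy : 0 <= y) by (destruct H as (_ & Hy & _); lia).
  revert x H.
  induction y as [y IH] using (well_founded_induction (Z.lt_wf 0)).
  intros x H.
  destruct (Z_le_gt_dec y 12) as [Hle | Hgt].
  - destruct (S_set_small x y H Hle) as [-> | [-> | ->]];
      [exists 1%nat | exists 2%nat | exists 3%nat]; now split; [lia |].
  - destruct (S_set_descent x y H ltac:(lia)) as [H' Hdec].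
    assert (Hy' : 0 <= - 6 * x + 19 * y + 6)
      by (destruct H' as (_ & Hy' & _); lia).
    destruct (IH _ (conj Hy' Hdec) Hy' _ H') as (n & Hn & En).
    exists (3 + n)%nat. split; [lia |].
    rewrite xy_seq_step, <- En. f_equal; lia.
Qed.

Theorem proposition2 :
  forall p : Z * Z,
    S_set p <-> exists n : nat, (1 <= n)%nat /\ p = xy_seq n.
Proof.
  intros [x y]. split.
  - apply S_set_in_xy_seq.
  - intros ([|n] & Hn & ->); [lia |]. apply xy_seq_in_S_set.
Qed.
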